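(* Let $\mu\in\mathcal{M}^1(\Omega)$. The following statements are equivalent: (i) $\mu$ satisfies the uniform $\ell^2$-Gaussian concentration bound, i.e. there exists $C>0$ such that for all finite nonempty $\Lambda\subset\mathbb{Z}^d$ and all $f\in\mathrm{Loc}(\Omega_\Lambda)$, $$\log\int e^{f-\mu(f)}\,d\mu\le\frac{C}{2}\|\delta f\|_2^2;$$ (ii) there exists $C>0$ such that, for all finite nonempty $\Lambda\subset\mathbb{Z}^d$ and all $\nu\in\mathcal{M}^1(\Omega)$, $$Q_{2,\Lambda}(\mu,\nu)\le\sqrt{2C\,s_\Lambda(\nu|\mu)}.$$
   Context: $S$ is a finite set, $d\ge1$, $\Omega=S^{\mathbb{Z}^d}$ with the product of discrete topologies and its Borel $\sigma$-algebra, $\mathcal{M}^1(\Omega)$ is the set of Borel probability measures on $\Omega$, and $\mu(f)=\int f\,d\mu$. For finite nonempty $\Lambda\subset\mathbb{Z}^d$, $\Omega_\Lambda=S^\Lambda$, $\mathrm{Loc}(\Omega_\Lambda)$ is the set of functions $f:\Omega\to\mathbb{R}$ such that $f(\sigma)$ depends only on $(\sigma_i)_{i\in\Lambda}$, and $\mu_\Lambda$ is the marginal of $\mu$ on $\Omega_\Lambda$. The oscillation of $f$ at $i$ is $\delta_i f=\sup\{f(\sigma)-f(\tilde\sigma):\sigma_j=\tilde\sigma_j\ \forall j\ne i\}$ and $\|\delta f\|_2^2=\sum_i(\delta_i f)^2$. Relative entropy in volume $\Lambda$: $s_\Lambda(\nu|\mu)=\sum_{\sigma\in\Omega_\Lambda}\nu_\Lambda(\sigma)\log\frac{\nu_\Lambda(\sigma)}{\mu_\Lambda(\sigma)}$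 if $\nu_\Lambda\ll\mu_\Lambda$ (with $0\log 0=0$), and $+\infty$ otherwise. $Q_{2,\Lambda}(\mu,\nu)=\Big(\inf_{\Pi}\sum_{i\in\Lambda}\big(\Pi\{\sigma^{(1)}_i\ne\sigma^{(2)}_i\}\big)^2\Big)^{1/2}$, the infimum being over all couplings $\Pi$ of $\mu_\Lambda$ and $\nu_\Lambda$, i.e. probability measures on $\Omega_\Lambda\times\Omega_\Lambda$ (generic point $(\sigma^{(1)},\sigma^{(2)})$) with marginals $\mu_\Lambda$ and $\nu_\Lambda$. *)

(* Defs.v *)
From HB Require Import structures.
From mathcomp Require Import all_boot all_order all_algebra finmap.
From mathcomp Require Import all_classical all_reals all_analysis.

Set Implicit Arguments.
Unset Strict Implicit.
Unset Printing Implicit Defensive.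

Import Order.TTheory GRing.Theory Num.Theory.

Local Open Scope classical_set_scope.
Local Open Scope ring_scope.

(* Nonempty finite sets. Measurable types are pointed in the library, and there
   is no probability measure on the configurations over an empty spin set. *)
#[short(type="pfinType")]
HB.structure Definition PointedFinite := {T of Finite T & Pointed T}.

Notation lattice d := 'rV[int]_d.

Definition configuration_space (d : nat) (S : pfinType) : Type :=
  {ptws lattice d -> discrete_topology S}.

HB.instance Definition _ (d : nat) (S : pfinType) :=
  Topological.on (configuration_space d S).
HB.instance Definition _ (d : nat) (S : pfinType) :=
  isPointed.Build (configuration_space d S) (fun=> point).

Definition configuration (d : nat) (S : pfinType) :=
  g_sigma_algebraType (@open (configuration_space d S)).

HB.instance Definition _ (d : nat) (S : pfinType) :=
  Measurable.on (configuration d S).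

Definition local_configuration (d : nat) (S : pfinType)
  (L : {fset lattice d}) : Type := {ffun L -> S}.

HB.instance Definition _ (d : nat) (S : pfinType) (L : {fset lattice d}) :=
  Finite.copy (local_configuration S L) {ffun L -> S}.
HB.instance Definition _ (d : nat) (S : pfinType) (L : {fset lattice d}) :=
  isPointed.Build (local_configuration S L) [ffun=> point].
HB.instance Definition _ (d : nat) (S : pfinType) (L : {fset lattice d}) :=
  @isMeasurable.Build default_measure_display (local_configuration S L)
    discrete_measurable discrete_measurable0
    discrete_measurableC discrete_measurableU.

Definition restriction (d : nat) (S : pfinType) (L : {fset lattice d})
  (s : configuration d S) : local_configuration S L := [ffun i => s (val i)].

Lemma measurable_restriction (d : nat) (S : pfinType) (L : {fset lattice d}) :
  measurable_fun setT (@restriction d S L).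
Proof.
pose res (s : configuration_space d S) : local_configuration S L :=
  restriction L s.
have nbhs_eq (s : configuration_space d S) (i : lattice d) :
    nbhs s [set t : configuration_space d S | t i = s i].
  exact: (@proj_continuous _ (fun=> discrete_topology S) i s _
    (discrete_set1 (s i : discrete_topology S))).
have open_res (A : set (local_configuration S L)) : open (res @^-1` A).
  rewrite openE => s As.
  apply: (@filterS _ (nbhs s) _ (\bigcap_(i in [set` L])
    [set t : configuration_space d S | t i = s i])).
    move=> t ts; rewrite /preimage/=.
    suff -> : res t = res s by [].
    by apply/ffunP => i; rewrite !ffunE; exact/ts/valP.
  by apply: filter_bigI => i _; exact: nbhs_eq.
by move=> _ A _; rewrite setTI; apply: sub_sigma_algebra; exact: open_res.
Qed.

HB.instance Definition _ (d : nat) (S : pfinType) (L : {fset lattice d}) :=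
  isMeasurableFun.Build _ _ _ _ (@restriction d S L)
    (@measurable_restriction d S L).

Section definitions.
Variables (R : realType) (d : nat) (S : pfinType).
Implicit Types (L : {fset lattice d}) (f : configuration d S -> R).
Implicit Types mu nu : probability (configuration d S) R.
Local Open Scope ereal_scope.

Definition loc L : set (configuration d S -> R) :=
  [set f | forall s t : configuration d S,
    (forall i, i \in L -> s i = t i) -> f s = f t].

Definition marginal L mu : probability (local_configuration S L) R :=
  distribution mu (@restriction d S L).

Definition oscillation f (i : lattice d) : \bar R :=
  ereal_sup [set r | exists s t : configuration d S,
    (forall j, j != i -> s j = t j) /\ r = (f s - f t)%:E].

Definition oscillation_sqnorm f : \bar R :=
  \esum_(i in [set: lattice d]) oscillation f i ^+ 2.

(* 0 log 0 = 0 needs no special case: by domination, a zero of the marginal of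
   mu is one of the marginal of nu, and the factor before ln is then 0. *)
Definition relative_entropy L nu mu : \bar R :=
  if `[< marginal L nu `<< marginal L mu >] then
    (\sum_(s : local_configuration S L)
      fine (marginal L nu [set s]) *
      ln (fine (marginal L nu [set s]) / fine (marginal L mu [set s])))%R%:E
  else +oo.

End definitions.

Definition couplings (d1 d2 : measure_display) (T1 : measurableType d1)
    (T2 : measurableType d2) (R : realType)
    (P1 : probability T1 R) (P2 : probability T2 R) :
    set (probability (T1 * T2)%type R) :=
  [set P | (forall A, measurable A -> P (fst @^-1` A) = P1 A) /\
           (forall B, measurable B -> P (snd @^-1` B) = P2 B)].

Definition Q2 (R : realType) (d : nat) (S : pfinType) (L : {fset lattice d})
    (mu nu : probability (configuration d S) R) : \bar R :=
  sqrte (ereal_inf [set (\sum_(i : L) P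
      [set x : local_configuration S L * local_configuration S L |
        x.1 i != x.2 i] ^+ 2)%E
    | P in couplings (marginal L mu) (marginal L nu)]).

(* Main.v *)
Require Import Defs.
From HB Require Import structures.
From mathcomp Require Import all_boot all_order all_algebra finmap.
From mathcomp Require Import all_classical all_reals all_analysis.
From mathcomp Require Import ring lra.

Set Implicit Arguments.
Unset Strict Implicit.
Unset Printing Implicit Defensive.

Import Order.TTheory GRing.Theory Num.Theory.

Local Open Scope classical_set_scope.
Local Open Scope ring_scope.

(* Everything takes place on the finite set X of configurations in the volume;
   let p and q be the marginals of mu and nu, and s the entropy of q given p.

   (ii) => (i): for q proportional to p e^f, the log-Laplace transform of
   f - p(f) equals q(f) - p(f) - s. Along a coupling, q(f) - p(f) is at most
   sum_i (delta_i f) P{x_i <> y_i}, and Young's inequality concludes.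

   (i) => (ii): by Hahn-Banach there is a coupling P satisfying, for all a >= 0
   and t > 0,
     sum_i a_i P{x_i <> y_i} <= s t + C |a|^2 / (2 t),
   as soon as phi(x) + psi(y) + sum_i a_i 1{x_i <> y_i} >= 0 implies
   p(phi) + q(psi) + s t + C |a|^2 / (2 t) >= 0. For the latter, put
   f(x) = min_y (psi(y) + sum_i a_i 1{x_i <> y_i}); then -phi <= f <= psi and
   delta_i f <= a_i, and one applies (i) and the Gibbs variational principle to
   - f / t. Finally take a_i = P{x_i <> y_i} and t = C. *)

(** * Domination of linear functionals by sublinear ones *)

(* [E v r] stands for [N v <= r] (up to closure), [N] a sublinear functional. *)
Definition epigraph_cone (R : realType) (V : lmodType R) (E : V -> R -> Prop) :=
  [/\ forall v v' r r', E v r -> E v' r' -> E (v + v') (r + r'),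
      forall v r t, 0 < t -> E v r -> E (t *: v) (t * r),
      forall v, exists r, E v r,
      forall r, E 0 r -> 0 <= r &
      forall e, 0 < e -> E 0 e].

(* [N v = w] and [N (- v) = - w], i.e. [N] is linear on the line through [v]. *)
Definition tight (R : realType) (V : lmodType R) (E : V -> R -> Prop) v w :=
  forall e, 0 < e -> E v (w + e) /\ E (- v) (- w + e).

(** One Hahn-Banach step: the sublinear functional is lowered just enough to become linear along
    [v], instead of extending a functional from a subspace. *)
Lemma epigraph_cone_extension (R : realType) (V : lmodType R)
    (E : V -> R -> Prop) (v : V) : epigraph_cone E ->
  exists E', [/\ epigraph_cone E', forall u r, E u r -> E' u r
    & exists w, tight E' v w].
Proof.
move=> [ED EZ Etot E0 Ee].
pose w := inf [set r | E v r].
have hi : has_inf [set r | E v r].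
  split; first by have [r vr] := Etot v; exists r.
  have [r' vr'] := Etot (- v); exists (- r') => r /= vr.
  by have := ED _ _ _ _ vr vr'; rewrite subrr => /E0; lra.
have wle r : E v r -> w <= r by move=> vr; apply: ge_inf => //; case: hi.
(* The epigraph of [u |-> inf_(t >= 0) (N (u + t v) - t N v)], where [w = N v]. *)
exists (fun u r => exists2 t, 0 <= t & E (u + t *: v) (r + t * w)); split.
- split.
  + move=> u u' r r' [t t0 ut] [t' t0' ut']; exists (t + t'); first exact: addr_ge0.
    have := ED _ _ _ _ ut ut'.
    by rewrite addrACA -scalerDl [X in E _ X -> _]addrACA -mulrDl.
  + move=> u r c c0 [t t0 ut]; exists (c * t); first by rewrite mulr_ge0// ltW.
    by have := EZ _ _ _ c0 ut; rewrite scalerDr scalerA mulrDr mulrA.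
  + by move=> u; have [r ur] := Etot u; exists r, 0 => //; rewrite scale0r mul0r !addr0.
  + move=> r [t]; rewrite le_eqVlt add0r => /predU1P[<-|t0].
      by rewrite scale0r mul0r addr0 => /E0.
    (* Dividing by [t] gives [E v (r / t + w)]; as [w] is a lower bound, [0 <= r / t]. *)
    have ti : 0 < t^-1 by rewrite invr_gt0.
    move=> /(EZ _ _ _ ti); rewrite scalerA mulVf ?gt_eqF// scale1r => /wle.
    rewrite mulrDr mulrA mulVf ?gt_eqF// mul1r lerDr pmulr_rge0 //.
  + by move=> e e0; exists 0 => //; rewrite scale0r mul0r !addr0; exact: Ee.
- by move=> u r ur; exists 0 => //; rewrite scale0r mul0r !addr0.
exists w => e e0; split.
  exists 0 => //; rewrite scale0r mul0r !addr0.
  have [r /= vr rw] := inf_adherent e0 hi.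
  (* Membership is known only at some [r < w + e]; adding [E 0 (w + e - r)] raises the level to
     [w + e]. *)
  have := ED _ _ _ _ vr (Ee (w + e - r) _).
  by rewrite addr0 [r + _]addrC subrK; apply; rewrite subr_gt0.
exists 1 => //; rewrite scale1r addNr mul1r addrAC addNr add0r; exact: Ee.
Qed.

(** Epigraphs only grow from step to step, so tightness along earlier vectors survives. *)
Lemma epigraph_cone_extension_seq (R : realType) (V : lmodType R)
    (E : V -> R -> Prop) (s : seq V) : epigraph_cone E ->
  exists E', [/\ epigraph_cone E', forall u r, E u r -> E' u r
    & forall v, v \in s -> exists w, tight E' v w].
Proof.
elim: s E => [|v s IH] E HE; first by exists E.
have [E1 [HE1 EE1 [w vw]]] := epigraph_cone_extension v HE.
have [E2 [HE2 E12 sw]] := IH _ HE1.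
exists E2; split => // [u r /EE1/E12//|u].
rewrite in_cons => /predU1P[->|/sw//].
by exists w => e /vw[? ?]; split; apply: E12.
Qed.

Lemma tight0 (R : realType) (V : lmodType R) (E : V -> R -> Prop) :
  epigraph_cone E -> tight E 0 0.
Proof. by move=> [_ _ _ _ Ee] e e0; rewrite !oppr0 add0r; split; exact: Ee. Qed.

Lemma tightD (R : realType) (V : lmodType R) (E : V -> R -> Prop) v v' w w' :
  epigraph_cone E -> tight E v w -> tight E v' w' -> tight E (v + v') (w + w').
Proof.
move=> [ED _ _ _ _] vw vw' e e0.
have e20 : 0 < e / 2 by rewrite divr_gt0.
have [a b] := vw _ e20; have [a' b'] := vw' _ e20.
rewrite {2}(splitr e) {1}(splitr e) !opprD addrACA [X in E _ X /\ _]addrACA; split.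
  by rewrite [X in E _ X]addrACA; exact: ED.
by rewrite addrACA; exact: ED.
Qed.

Lemma tightZ (R : realType) (V : lmodType R) (E : V -> R -> Prop) v w (t : R) :
  epigraph_cone E -> tight E v w -> tight E (t *: v) (t * w).
Proof.
move=> HE; have [_ EZ _ _ _] := HE.
have pos u x c : 0 < c -> tight E u x -> tight E (c *: u) (c * x).
  move=> c0 ux e e0; have [a b] := ux _ (divr_gt0 e0 c0).
  move: (EZ _ _ _ c0 a) (EZ _ _ _ c0 b).
  by rewrite !mulrDr mulrN scalerN [c * (e / c)]mulrC divfK ?gt_eqF.
have opp u x : tight E u x -> tight E (- u) (- x).
  by move=> ux e /ux[? ?]; rewrite !opprK.
move=> vw; have [t0|t0|->] := ltgtP t 0.
- rewrite -[t]opprK scaleNr mulNr; apply/opp/pos => //; lra.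
- exact: pos.
- by rewrite scale0r mul0r; exact: tight0.
Qed.

(** Tightness on the basis of point masses spreads by linearity to every [h]. Adding [E' h r] to the
    bound at [- h] leaves a nonnegativity at 0, which is the claim up to [e]. *)
Lemma dominated_functional (R : realType) (Z : finType)
    (E : {ffun Z -> R^o} -> R -> Prop) : epigraph_cone E ->
  exists w : Z -> R, forall h r, E h r -> \sum_z h z * w z <= r.
Proof.
move=> HE.
pose delta z : {ffun Z -> R^o} := [ffun z' => (z' == z)%:R].
have [E' [HE' EE' tE]] := epigraph_cone_extension_seq (map delta (enum Z)) HE.
have /(_ _)/cid tz z : exists w, tight E' (delta z) w.
  by apply: tE; apply: map_f; rewrite mem_enum.
exists (fun z => projT1 (tz z)) => h r hr.
have : tight E' h (\sum_z h z * projT1 (tz z)).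
  have {1}-> : h = \sum_z (h z : R) *: delta z.
    apply/ffunP => z; rewrite sum_ffunE (bigD1 z)//= !ffunE eqxx.
    rewrite big1 ?addr0; first exact/esym/mulr1.
    move=> z' zz'; rewrite !ffunE eq_sym (negbTE zz').
    exact: mulr0.
  elim/big_ind2 : _ => [|u x u' x'|z _]; first exact: tight0.
    exact: tightD.
  by apply: tightZ => //; exact: projT2.
move=> th; apply/ler_addgt0Pr => e e0; have [_ hs] := th _ e0.
have [ED _ _ E0 _] := HE'.
have := ED _ _ _ _ (EE' _ _ hr) hs; rewrite subrr => /E0; lra.
Qed.

(** * Existence of couplings by duality *)

(* The infimum over [t > 0] of the last two terms is [sqrt (2 C s) |a|]; keeping
   [t] as a variable makes their joint convexity elementary. *)
Definition dual_value (R : realType) (X Y J : finType) (p : X -> R)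
    (q : Y -> R) (s C : R) (phi : X -> R) (psi : Y -> R) (a : J -> R) (t : R) :=
  \sum_x p x * phi x + \sum_y q y * psi y + s * t
    + C / 2 * \sum_j a j ^+ 2 / t.

(** [phi] and [psi] act as multipliers of the two marginal constraints, [a j] as the multiplier of
    the [j]-th transport cost. *)
Definition dual_feasible (R : realType) (X Y J : finType)
    (c : J -> X * Y -> R) (h : X * Y -> R) (phi : X -> R) (psi : Y -> R)
    (a : J -> R) (t : R) :=
  [/\ forall j, 0 <= a j, 0 < t
    & forall z, h z <= phi z.1 + psi z.2 + \sum_j a j * c j z].

Definition fin_coupling (R : realType) (X Y : finType)
    (p : X -> R) (q : Y -> R) (w : X * Y -> R) :=
  [/\ forall z, 0 <= w z, forall x, \sum_y w (x, y) = p x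
    & forall y, \sum_x w (x, y) = q y].

(** Joint convexity of the perspective [a ^+ 2 / t], which is homogeneous of degree 1: the gap is a
    square over a positive number. *)
Lemma sqr_div_subadd (R : realFieldType) (a b s t : R) : 0 < s -> 0 < t ->
  (a + b) ^+ 2 / (s + t) <= a ^+ 2 / s + b ^+ 2 / t.
Proof.
move=> s0 t0; rewrite ler_pdivrMr ?addr_gt0// -subr_ge0.
have -> : (a ^+ 2 / s + b ^+ 2 / t) * (s + t) - (a + b) ^+ 2 =
    (a * t - b * s) ^+ 2 / (s * t).
  by field; rewrite !gt_eqF.
by rewrite divr_ge0 ?sqr_ge0// mulr_ge0// ltW.
Qed.

(** Feasibility is stable under sums and positive multiples, and the dual value is subadditive and
    homogeneous. The hypothesis says exactly that the resulting functional is nonnegative at 0. *)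
Lemma dual_epigraph_cone (R : realType) (X Y J : finType) (p : X -> R)
    (q : Y -> R) (s C : R) (c : J -> X * Y -> R) : 0 <= s -> 0 < C ->
  (forall phi psi a t, dual_feasible c (fun=> 0) phi psi a t ->
    0 <= dual_value p q s C phi psi a t) ->
  epigraph_cone (fun (h : {ffun X * Y -> R^o}) r =>
    exists phi psi a t, dual_feasible c h phi psi a t /\
      dual_value p q s C phi psi a t <= r).
Proof.
move=> s0 C0 pos; split.
- move=> h h' r r' [phi [psi [a [t [[a0 t0 hle] vr]]]]].
  move=> [phi' [psi' [a' [t' [[a0' t0' hle'] vr']]]]].
  exists (fun x => phi x + phi' x), (fun y => psi y + psi' y),
    (fun j => a j + a' j), (t + t'); split.
    split; [by move=> j; rewrite addr_ge0|by rewrite addr_gt0|move=> z].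
    rewrite ffunE (eq_bigr (fun j => a j * c j z + a' j * c j z)); last first.
      by move=> j _; rewrite mulrDl.
    rewrite big_split/=; have := hle z; have := hle' z; lra.
  apply: le_trans (lerD vr vr'); rewrite /dual_value.
  under eq_bigr do rewrite mulrDr.
  under [X in _ + X + _ + _]eq_bigr do rewrite mulrDr.
  rewrite !big_split/=.
  have : C / 2 * \sum_j (a j + a' j) ^+ 2 / (t + t') <=
      C / 2 * (\sum_j a j ^+ 2 / t + \sum_j a' j ^+ 2 / t').
    rewrite ler_pM2l ?divr_gt0// -big_split/=.
    by apply: ler_sum => j _; exact: sqr_div_subadd.
  lra.
- move=> h r k k0 [phi [psi [a [t [[a0 t0 hle] vr]]]]].
  exists (fun x => k * phi x), (fun y => k * psi y),
    (fun j => k * a j), (k * t); split.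
    split; [by move=> j; rewrite mulr_ge0// ltW|by rewrite mulr_gt0|move=> z].
    rewrite ffunE (eq_bigr (fun j => k * (a j * c j z))); last first.
      by move=> j _; rewrite mulrA.
    by rewrite -mulr_sumr -!mulrDr; apply: ler_wpM2l => //; rewrite ltW.
  apply: le_trans (ler_wpM2l (ltW k0) vr); rewrite /dual_value.
  under eq_bigr do rewrite mulrCA.
  under [X in _ + X + _ + _]eq_bigr do rewrite mulrCA.
  have -> : \sum_j (k * a j) ^+ 2 / (k * t) = k * \sum_j a j ^+ 2 / t.
    rewrite mulr_sumr; apply: eq_bigr => j _.
    by field; rewrite !gt_eqF.
  rewrite -!mulr_sumr; lra.
- move=> h; exists (dual_value p q s C (fun=> \sum_z `|h z|) (fun=> 0) (fun _ : J => 0) 1).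
  exists (fun=> \sum_z `|h z|), (fun=> 0), (fun=> 0), 1.
  split; last exact: lexx.
  split => // z; rewrite [X in _ <= _ + X]big1 => [|j _]; last by rewrite /= mul0r.
  rewrite !addr0 (bigD1 z)//= (le_trans (ler_norm _))// lerDl.
  exact: sumr_ge0.
- move=> r [phi [psi [a [t [[a0 t0 hle] vr]]]]].
  apply: le_trans vr; apply: pos; split => // z.
  by apply: le_trans (hle z); rewrite ffunE.
(* [t] must be positive while [s * t <= e]; the [+ 1] covers [s = 0]. *)
- move=> e e0; exists (fun=> 0), (fun=> 0), (fun=> 0), (e / (s + 1)).
  have s1 : 0 < s + 1 by rewrite ltr_wpDl.
  split.
    split => //; first by rewrite divr_gt0.
    move=> z; rewrite big1 => [|j _]; last by rewrite /= mul0r.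
    by rewrite ffunE !addr0.
  rewrite /dual_value !big1 => [|j _|y _|x _]; last 3 first.
  - by rewrite /= expr0n mul0r.
  - by rewrite mulr0.
  - by rewrite mulr0.
  rewrite mulr0 !addr0 add0r mulrA ler_pdivrMr// mulrC ler_pM2l//; lra.
Qed.

Lemma pair_sum_fst (R : realType) (X Y : finType) (w : X * Y -> R) (f : X -> R) :
  \sum_z w z * f z.1 = \sum_x (\sum_y w (x, y)) * f x.
Proof.
rewrite (eq_bigr (fun z => w (z.1, z.2) * f z.1)); last by case.
rewrite -(pair_bigA _ (fun x y => w (x, y) * f x))/=.
by apply: eq_bigr => x _; rewrite mulr_suml.
Qed.

Lemma pair_sum_snd (R : realType) (X Y : finType) (w : X * Y -> R) (g : Y -> R) :
  \sum_z w z * g z.2 = \sum_y (\sum_x w (x, y)) * g y.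
Proof.
rewrite (eq_bigr (fun z => w (z.1, z.2) * g z.2)); last by case.
rewrite -(pair_bigA _ (fun x y => w (x, y) * g y))/= exchange_big/=.
by apply: eq_bigr => y _; rewrite mulr_suml.
Qed.

(** The weights of the dominated functional form the coupling: test functions with [a = 0] give
    their sign and marginals, and a choice of [a] and [t] gives the cost. *)
Lemma coupling_of_dual_bound (R : realType) (X Y J : finType) (p : X -> R)
    (q : Y -> R) (s C : R) (c : J -> X * Y -> R) : 0 <= s -> 0 < C ->
  (forall j z, 0 <= c j z) ->
  (forall phi psi a t, dual_feasible c (fun=> 0) phi psi a t ->
    0 <= dual_value p q s C phi psi a t) ->
  exists2 w, fin_coupling p q w
    & \sum_j (\sum_z w z * c j z) ^+ 2 <= 2 * C * s.
Proof.
move=> s0 C0 c0 /(dual_epigraph_cone s0 C0)/dominated_functional[w wE].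
have wle (h : X * Y -> R) phi psi a t : dual_feasible c h phi psi a t ->
    \sum_z w z * h z <= dual_value p q s C phi psi a t.
  move=> [a0 t0 hle].
  have := wE (finfun h) (dual_value p q s C phi psi a t).
  under eq_bigr do rewrite ffunE mulrC.
  apply; exists phi, psi, a, t; split => //; split => // z.
  by rewrite ffunE.
(* With [a = 0] the only penalty left is [s * t], which is made arbitrarily small through [t]. *)
have wle0 (h : X * Y -> R) phi psi :
    (forall z, h z <= phi z.1 + psi z.2) ->
    \sum_z w z * h z <= \sum_x p x * phi x + \sum_y q y * psi y.
  move=> hle; apply/ler_addgt0Pr => e e0.
  have s1 : 0 < s + 1 by rewrite ltr_wpDl.
  have := wle h phi psi (fun=> 0) (e / (s + 1)).
  rewrite /dual_value [X in C / 2 * X]big1 => [|j _]; last by rewrite /= expr0n mul0r.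
  rewrite mulr0 addr0 => /(_ _)/le_trans; apply.
    split; [by []|by rewrite divr_gt0|move=> z].
    by rewrite big1 => [|j _]; rewrite /= ?mul0r// addr0.
  rewrite lerD2l mulrA ler_pdivrMr// mulrC ler_pM2l//; lra.
have wsum0 (h : X * Y -> R) phi psi :
    (forall z, h z = phi z.1 + psi z.2) ->
    \sum_z w z * h z = \sum_x p x * phi x + \sum_y q y * psi y.
  move=> hE; apply/le_anti/andP; split; first by apply: wle0 => z; rewrite hE.
  have := wle0 (fun z => - h z) (fun x => - phi x) (fun y => - psi y).
  under eq_bigr do rewrite mulrN.
  under [X in _ -> _ <= X + _]eq_bigr do rewrite mulrN.
  under [X in _ -> _ <= _ + X]eq_bigr do rewrite mulrN.
  rewrite !sumrN -opprD lerN2; apply=> z.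
  by rewrite hE opprD.
have sum_at (T : finType) (f : T -> R) t : \sum_t' f t' * (t' == t)%:R = f t.
  rewrite (bigD1 t)//= eqxx mulr1 big1 ?addr0// => t' /negbTE ->.
  by rewrite mulr0.
have sum_0 (T : finType) (f : T -> R) : \sum_t f t * 0 = 0.
  by rewrite big1// => t _; rewrite mulr0.
have w0 z : 0 <= w z.
  have := wle0 (fun z' => - (z' == z)%:R) (fun=> 0) (fun=> 0).
  under eq_bigr do rewrite mulrN.
  rewrite sumrN sum_at !sum_0 addr0 oppr_le0; apply=> z'.
  by rewrite ?addr0 oppr_le0.
have cpl : fin_coupling p q w.
  split => // [x|y].
    have := wsum0 (fun z => (z.1 == x)%:R) (fun x' => (x' == x)%:R) (fun=> 0).
    rewrite (pair_sum_fst w (fun x' => (x' == x)%:R)) !sum_at sum_0 addr0.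
    by apply=> z; rewrite addr0.
  have := wsum0 (fun z => (z.2 == y)%:R) (fun=> 0) (fun y' => (y' == y)%:R).
  rewrite (pair_sum_snd w (fun y' => (y' == y)%:R)) !sum_at sum_0 add0r.
  by apply=> z; rewrite add0r.
exists w => //.
pose a j := \sum_z w z * c j z.
(* The functional evaluated at its own transport costs [a], with [t := C]. *)
have /wle : dual_feasible c (fun z => \sum_j a j * c j z)
    (fun=> 0) (fun=> 0) a C.
  split => // [j|z]; last by rewrite !add0r.
  by apply: sumr_ge0 => z _; rewrite mulr_ge0.
have -> : \sum_z w z * (\sum_j a j * c j z) = \sum_j a j ^+ 2.
  under eq_bigr do rewrite mulr_sumr.
  rewrite exchange_big/=; apply: eq_bigr => j _.
  by rewrite expr2 {2}/a mulr_sumr; apply: eq_bigr => z _; rewrite mulrCA.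
rewrite /dual_value !sum_0 !add0r -mulr_suml.
have -> A : C / 2 * (A / C) = A / 2 by field; rewrite gt_eqF.
(* The bound now reads [|a|^2 <= s C + |a|^2 / 2]. *)
rewrite -/a; lra.
Qed.

(** * Concentration and transport on a finite product *)

Definition fin_prob (R : realType) (X : finType) (p : X -> R) :=
  (forall x, 0 <= p x) /\ \sum_x p x = 1.

Definition fin_entropy (R : realType) (X : finType) (q p : X -> R) : R :=
  \sum_x q x * ln (q x / p x).

(** Upper bounds stand in for the exact oscillations, so that no supremum is computed on the finite
    side. *)
Definition osc_bound (R : realType) (I : finType) (S : eqType)
    (g : {ffun I -> S} -> R) (a : I -> R) :=
  forall i (x y : {ffun I -> S}), (forall j, j != i -> x j = y j) ->
    g x - g y <= a i.

Definition fin_gcb (R : realType) (I S : finType) (C : R)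
    (p : {ffun I -> S} -> R) :=
  forall g a, osc_bound g a ->
    ln (\sum_x p x * expR (g x - \sum_y p y * g y)) <= C / 2 * \sum_i a i ^+ 2.

Definition mismatch (R : realType) (I S : finType) (i : I)
  (z : {ffun I -> S} * {ffun I -> S}) : R := (z.1 i != z.2 i)%:R.

Lemma fin_prob_gt0 (R : realType) (X : finType) (p : X -> R) :
  fin_prob p -> exists x, 0 < p x.
Proof.
move=> [p0 p1]; apply/existsP; rewrite -[X in is_true X]negbK negb_exists.
apply/negP => /forallP np; have := oner_neq0 R.
by rewrite -p1 big1 ?eqxx// => x _; apply/le_anti; rewrite p0 leNgt np.
Qed.

Lemma fin_expsum_gt0 (R : realType) (X : finType) (p g : X -> R) :
  fin_prob p -> 0 < \sum_x p x * expR (g x).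
Proof.
move=> pp; have [x px] := fin_prob_gt0 pp.
rewrite (bigD1 x)//= ltr_pwDl//; first by rewrite mulr_gt0 ?expR_gt0.
by apply: sumr_ge0 => y _; rewrite mulr_ge0 ?expR_ge0//; case: pp.
Qed.

(** Pointwise, [1 + u <= expR u] at [u = g x - ln (q x / p x) - ln Z], multiplied by [q x]; after
    summation the right-hand side is [1 - 1]. *)
Lemma gibbs_variational (R : realType) (X : finType) (p q g : X -> R) :
  fin_prob p -> fin_prob q -> (forall x, p x = 0 -> q x = 0) ->
  \sum_x q x * g x <= fin_entropy q p + ln (\sum_x p x * expR (g x)).
Proof.
move=> pp [q0 q1] qp; have Z0 := fin_expsum_gt0 g pp.
have [p0 _] := pp; set Z := \sum_x p x * expR (g x) in Z0 *.
suff : \sum_x (q x * g x - q x * ln (q x / p x) - q x * ln Z) <=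
    \sum_x (p x * expR (g x) / Z - q x).
  rewrite !sumrB -!mulr_suml q1 mul1r -/Z divff ?gt_eqF// subrr.
  rewrite /fin_entropy; lra.
apply: ler_sum => x _; have := q0 x; rewrite le_eqVlt => /predU1P[<-|qx].
  by rewrite !mul0r !subr0 divr_ge0// ?(ltW Z0)// mulr_ge0// expR_ge0.
have px : 0 < p x.
  by rewrite lt_def p0 andbT; apply/eqP => /qp qx0; rewrite qx0 ltxx in qx.
have := expR_ge1Dx (g x - ln (q x / p x) - ln Z).
rewrite !expRD !expRN !lnK ?posrE ?divr_gt0// => /(ler_wpM2l (ltW qx)).
have -> : q x * (expR (g x) / (q x / p x) / Z) = p x * expR (g x) / Z.
  by field; rewrite !gt_eqF.
lra.
Qed.

Lemma fin_entropy_ge0 (R : realType) (X : finType) (p q : X -> R) :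
  fin_prob p -> fin_prob q -> (forall x, p x = 0 -> q x = 0) ->
  0 <= fin_entropy q p.
Proof.
move=> pp qq qp; have := gibbs_variational (fun=> 0) pp qq qp.
under eq_bigr do rewrite mulr0.
under [X in ln X]eq_bigr do rewrite expR0 mulr1.
by case: pp => _ ->; rewrite ln1 addr0 big1.
Qed.

Lemma ln_sum_centered (R : realType) (X : finType) (p g : X -> R) m :
  fin_prob p -> ln (\sum_x p x * expR (g x - m)) =
    ln (\sum_x p x * expR (g x)) - m.
Proof.
move=> pp; under eq_bigr do rewrite expRD expRN mulrA.
rewrite -mulr_suml lnM ?posrE ?invr_gt0 ?expR_gt0//; last exact: fin_expsum_gt0.
by rewrite lnV ?posrE ?expR_gt0// expRK.
Qed.

Lemma fin_gcb_transport (R : realType) (I S : finType) (C : R)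
    (p q : {ffun I -> S} -> R) : 0 < C -> fin_prob p -> fin_prob q ->
  (forall x, p x = 0 -> q x = 0) -> fin_gcb C p ->
  exists2 w, fin_coupling p q w &
    \sum_i (\sum_z w z * mismatch R i z) ^+ 2 <= 2 * C * fin_entropy q p.
Proof.
move=> C0 pp qq qp gcb; have s0 := fin_entropy_ge0 pp qq qp.
apply: coupling_of_dual_bound => // phi psi a t [a0 t0 feas].
have [[p0 p1] [q0 q1]] := (pp, qq).
pose dist (x y : {ffun I -> S}) := \sum_i a i * mismatch R i (x, y).
(* [f] is the infimal convolution of [psi] with the weighted Hamming distance [dist], and [y_ x] a
   point where the minimum is attained. *)
pose y_ x := [arg min_(y < x) (psi y + dist x y)]%O.
pose f x := psi (y_ x) + dist x (y_ x).
have fle x y : f x <= psi y + dist x y.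
  by rewrite /f /y_; case: arg_minP => // z _; exact.
have f_psi x : f x <= psi x.
  rewrite (le_trans (fle x x))// /dist big1 ?addr0// => i _.
  by rewrite /mismatch/= eqxx mulr0.
have f_phi x : - phi x <= f x.
  by rewrite lerNl -subr_ge0 opprK addrA; exact: feas (x, y_ x).
(* The minimizer for [x] competes in the minimum for [y], and the two distances to it differ only in
   the [i]-th term. *)
have osc : osc_bound (fun x => - (f x / t)) (fun i => a i / t).
  move=> i x y xy; rewrite opprK addrC -mulrBl ler_pM2r ?invr_gt0//.
  rewrite lerBlDl (le_trans (fle y (y_ x)))// /f -addrA lerD2l.
  rewrite /dist (bigD1 i)//= [X in _ <= X + _](bigD1 i)//= addrAC.
  rewrite lerD//; last first.
    by apply: ler_sum => j ji; rewrite /mismatch/= xy.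
  rewrite /mismatch; have := a0 i.
  by case: (y i != _); case: (x i != _); rewrite /= ?mulr1 ?mulr0; lra.
have := gcb _ _ osc; rewrite ln_sum_centered//.
have := gibbs_variational (fun x => - (f x / t)) pp qq qp.
rewrite /dual_value.
have meanE r : \sum_x r x * - (f x / t) = - (\sum_x r x * f x) / t.
  by rewrite -sumrN mulr_suml; apply: eq_bigr => x _; rewrite mulrN mulrA mulNr.
have -> : \sum_i (a i / t) ^+ 2 = (\sum_i a i ^+ 2) / t ^+ 2.
  by rewrite mulr_suml; apply: eq_bigr => i _; rewrite expr_div_n.
rewrite !meanE -mulr_suml.
have : \sum_x p x * - phi x <= \sum_x p x * f x.
  by apply: ler_sum => x _; exact: ler_wpM2l.
have : \sum_x q x * f x <= \sum_x q x * psi x.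
  by apply: ler_sum => x _; exact: ler_wpM2l.
under [\sum_x p x * - phi x]eq_bigr do rewrite mulrN.
rewrite sumrN.
set P := \sum_x p x * phi x; set Q := \sum_x q x * psi x.
set pf := \sum_x p x * f x; set qf := \sum_x q x * f x.
set A := \sum_i a i ^+ 2; set Z := ln _; set s := fin_entropy q p.
move=> Qf Pf h1 h2.
(* [Z] cancels between concentration and the variational principle; multiplying by [t] yields the
   two penalty terms of the dual value. *)
have : (pf - qf) / t <= s + C / 2 * (A / t ^+ 2) by lra.
rewrite ler_pdivrMr//.
have -> : (s + C / 2 * (A / t ^+ 2)) * t = s * t + C / 2 * (A / t).
  by field; rewrite gt_eqF.
lra.
Qed.

(** Telescoping: the coordinates of [z.1] are replaced by those of [z.2] one at a time, and the
    [i]-th replacement changes nothing unless they differ at [i]. *)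
Lemma osc_bound_mismatch (R : realType) (I S : finType)
    (g : {ffun I -> S} -> R) (a : I -> R) z : osc_bound g a ->
  g z.2 - g z.1 <= \sum_i a i * mismatch R i z.
Proof.
move=> osc; have a0 i : 0 <= a i by rewrite -(subrr (g z.1)) osc.
pose mix (r : seq I) := [ffun i => if i \in r then z.2 i else z.1 i].
have mixP r : g (mix r) - g z.1 <= \sum_(i <- r) a i * mismatch R i z.
  elim: r => [|i r IH].
    rewrite big_nil; have -> : mix [::] = z.1 by apply/ffunP => i; rewrite ffunE.
    by rewrite subrr.
  rewrite big_cons -(subrKA (g (mix r))) lerD//; rewrite /mismatch.
  have [e|ne] := eqVneq (z.1 i) (z.2 i).
    rewrite mulr0 subr_le0; suff -> : mix (i :: r) = mix r by [].
    apply/ffunP => j; rewrite !ffunE in_cons; have [->|//] := eqVneq j i.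
    by case: ifP => //=; rewrite e.
  rewrite mulr1; apply: osc => j ji.
  by rewrite !ffunE in_cons (negbTE ji).
have := mixP (index_enum I); suff -> : mix (index_enum I) = z.2 by [].
by apply/ffunP => i; rewrite ffunE mem_index_enum.
Qed.

(** The Gibbs measure of [g] relative to [p], which attains equality in the variational
    principle. *)
Definition tilt (R : realType) (X : finType) (p g : X -> R) x : R :=
  p x * expR (g x) / \sum_y p y * expR (g y).

Lemma fin_prob_tilt (R : realType) (X : finType) (p g : X -> R) :
  fin_prob p -> fin_prob (tilt p g).
Proof.
move=> pp; have Z0 := fin_expsum_gt0 g pp; have [p0 _] := pp; split=> [x|].
  by rewrite divr_ge0 ?mulr_ge0 ?expR_ge0// ltW.
by rewrite -mulr_suml divff ?gt_eqF.
Qed.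

Lemma fin_entropy_tilt (R : realType) (X : finType) (p g : X -> R) :
  fin_prob p -> fin_entropy (tilt p g) p =
    \sum_x tilt p g x * g x - ln (\sum_x p x * expR (g x)).
Proof.
move=> pp; have Z0 := fin_expsum_gt0 g pp; have [p0 _] := pp.
have [_ q1] := fin_prob_tilt g pp.
rewrite -[ln _]mul1r -q1 mulr_suml -sumrB; apply: eq_bigr => x _.
rewrite -mulrBr; have [px0|px0] := eqVneq (p x) 0.
  by rewrite /tilt px0 !mul0r.
congr (_ * _); have -> : tilt p g x / p x = expR (g x) / \sum_y p y * expR (g y).
  by rewrite /tilt; field; rewrite px0 gt_eqF.
by rewrite lnM ?posrE ?invr_gt0 ?expR_gt0// lnV ?posrE// expRK.
Qed.

(** The slack [e] is there because [Q2] is an infimum and supplies only nearly optimal couplings. *)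
Lemma fin_transport_gcb (R : realType) (I S : finType) (C : R)
    (p g : {ffun I -> S} -> R) (a : I -> R) : 0 < C -> fin_prob p ->
  (forall e, 0 < e -> exists2 w, fin_coupling p (tilt p g) w &
    \sum_i (\sum_z w z * mismatch R i z) ^+ 2 <=
      2 * C * fin_entropy (tilt p g) p + e) ->
  osc_bound g a ->
  ln (\sum_x p x * expR (g x - \sum_y p y * g y)) <= C / 2 * \sum_i a i ^+ 2.
Proof.
move=> C0 pp cpl osc; rewrite ln_sum_centered//; apply/ler_addgt0Pr => e e0.
(* This slack becomes [e] after the division by [2 * C] in Young's inequality. *)
have [w [w0 w1 w2]] := cpl (2 * C * e) (mulr_gt0 (mulr_gt0 (ltr0n _ 2) C0) e0).
set W := fun i => \sum_z w z * mismatch R i z; rewrite fin_entropy_tilt// => cost.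
have : \sum_x tilt p g x * g x - \sum_x p x * g x <= \sum_i a i * W i.
  have -> : \sum_x tilt p g x * g x = \sum_z w z * g z.2.
    by rewrite pair_sum_snd; apply: eq_bigr => y _; rewrite w2.
  have -> : \sum_x p x * g x = \sum_z w z * g z.1.
    by rewrite pair_sum_fst; apply: eq_bigr => y _; rewrite w1.
  have -> : \sum_i a i * W i = \sum_z w z * \sum_i a i * mismatch R i z.
    under eq_bigr do rewrite mulr_sumr; rewrite exchange_big/=.
    apply: eq_bigr => z _; rewrite mulr_sumr.
    by apply: eq_bigr => i _; rewrite mulrCA.
  rewrite -sumrB; apply: ler_sum => z _; rewrite -mulrBr ler_wpM2l//.
  exact: osc_bound_mismatch.
(* Young: [a W <= C a^2 / 2 + W^2 / (2 C)] *)
have : \sum_i a i * W i <=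
    C / 2 * \sum_i a i ^+ 2 + (2 * C)^-1 * \sum_i W i ^+ 2.
  rewrite !mulr_sumr -big_split/=; apply: ler_sum => i _; rewrite -subr_ge0.
  have -> : C / 2 * a i ^+ 2 + (2 * C)^-1 * W i ^+ 2 - a i * W i =
      (2 * C)^-1 * (C * a i - W i) ^+ 2 by field; rewrite gt_eqF.
  by rewrite mulr_ge0 ?sqr_ge0// invr_ge0 mulr_ge0// ltW.
(* The entropy of the tilted measure contains its mean of [g], which cancels, and minus the
   log-Laplace transform, which moves to the left. *)
have := cost; rewrite -/W -mulrDr -ler_pdivrMl ?mulr_gt0//; lra.
Qed.

(** * Probabilities with finite support *)

(** A function factoring through a finite type is a finite combination of indicators of the
    fibres. *)
Lemma integrable_fin_factor d (T : measurableType d) (R : realType)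
    (P : probability T R) (I : finType) (h : T -> I) (g : I -> R) :
  (forall B, measurable (h @^-1` B)) ->
  P.-integrable setT (EFin \o (g \o h)) /\
  (\int[P]_t (g (h t))%:E)%E =
    (\sum_i g i * fine (P (h @^-1` [set i])))%:E.
Proof.
move=> mh.
have int i : P.-integrable setT
    (fun t => (g i)%:E * (\1_(h @^-1` [set i]) t)%:E)%E.
  apply: integrableZl => //; apply: integrable_indic => //.
have ghE t : (g (h t))%:E =
    (\sum_i (g i)%:E * (\1_(h @^-1` [set i]) t)%:E)%E.
  rewrite (bigD1 (h t))//= indicE mem_set//= mule1 big1 ?adde0// => i ne.
  by rewrite indicE memNset ?mule0// => /= e; rewrite e eqxx in ne.
split.
  rewrite (_ : _ \o _ = (fun t =>
      \sum_i (g i)%:E * (\1_(h @^-1` [set i]) t)%:E)%E); last first.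
    by apply/funext => t; rewrite /= ghE.
  exact: integrable_sum.
under eq_integral do rewrite ghE.
rewrite integral_sum// -sumEFin; apply: eq_bigr => i _.
rewrite integralZl//; last exact: integrable_indic.
by rewrite integral_indic// setIT EFinM fineK// fin_num_measure.
Qed.

Lemma probability_preimage_sum d (T : measurableType d) (R : realType)
    (P : probability T R) (I : finType) (h : T -> I) (B : pred I) :
  (forall B, measurable (h @^-1` B)) ->
  P (h @^-1` [set` B]) = (\sum_(i | B i) fine (P (h @^-1` [set i])))%:E.
Proof.
move=> mh; have [_] := integrable_fin_factor P (fun i => (B i)%:R) mh.
under eq_integral => t _.
  rewrite (_ : (B (h t))%:R = \1_(h @^-1` [set` B]) t); last first.
    rewrite indicE; have [Bt|/negP Bt] := boolP (B (h t)).
      by rewrite mem_set.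
    by rewrite memNset.
  over.
rewrite integral_indic// setIT => ->; congr EFin.
rewrite [RHS]big_mkcond; apply: eq_bigr => i _.
by case: (B i); rewrite ?mul1r ?mul0r.
Qed.

Lemma fin_prob_preimage d (T : measurableType d) (R : realType)
    (P : probability T R) (I : finType) (h : T -> I) :
  (forall B, measurable (h @^-1` B)) ->
  fin_prob (fun i => fine (P (h @^-1` [set i]))).
Proof.
move=> mh; split=> [i|]; first exact: fine_ge0.
have := probability_preimage_sum P predT mh.
rewrite (_ : h @^-1` _ = setT); last by apply/seteqP.
by rewrite probability_setT => -[].
Qed.

Lemma exists_discrete_probability d (T : measurableType d) (R : realType)
    (I : finType) (e : I -> T) (w : I -> R) : fin_prob w ->
  exists P : probability T R, forall A, P A = (\sum_i w i * \1_A (e i))%:E.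
Proof.
move=> ww; have [i0 _] := fin_prob_gt0 ww; have [w0 w1] := ww.
(* A weighted sum of Dirac masses; [msum] runs over natural numbers, hence the enumeration of [I],
   with [i0] as default for [nth]. *)
pose m : {measure set T -> \bar R} := msum (fun k =>
  mscale (NngNum (w0 (nth i0 (enum I) k))) (dirac (e (nth i0 (enum I) k)))) #|I|.
have mE A : m A = (\sum_i w i * \1_A (e i))%:E.
  rewrite -sumEFin -big_enum/= (big_nth i0) -cardE big_mkord.
  by apply: eq_bigr.
have m1 : m setT = 1%E.
  by rewrite mE; under eq_bigr do rewrite indicT mulr1; rewrite w1.
pose mP := Measure_isProbability.Build _ _ _ m m1.
pose P : probability T R := HB.pack (Measure.sort m) (Measure.class m) mP.
by exists P => A; exact: mE.
Qed.

(** * Marginals, local functions and couplings *)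

Definition marginal_weight (R : realType) (d : nat) (S : pfinType)
    (L : {fset lattice d}) (mu : probability (configuration d S) R)
    (x : {ffun L -> S}) : R := fine (marginal L mu [set x]).

(** A section of the restriction; the spins chosen outside the volume are invisible to local
    functions. *)
Definition extension (d : nat) (S : pfinType) (L : {fset lattice d})
    (x : {ffun L -> S}) : configuration d S :=
  fun i => if insub i is Some j then x j else point.

Lemma extension_val (d : nat) (S : pfinType) (L : {fset lattice d})
  (x : {ffun L -> S}) (j : L) : extension x (val j) = x j.
Proof. by rewrite /extension valK. Qed.

Lemma extensionK (d : nat) (S : pfinType) (L : {fset lattice d}) :
  cancel (@extension d S L) (@restriction d S L).
Proof. by move=> x; apply/ffunP => j; rewrite ffunE extension_val. Qed.

Lemma loc_extension (R : realType) (d : nat) (S : pfinType)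
    (L : {fset lattice d}) (f : configuration d S -> R) s : loc L f ->
  f s = f (extension (restriction L s)).
Proof.
move=> Lf; apply: Lf => i iL.
by rewrite (_ : i = val [` iL]%fset)// extension_val ffunE.
Qed.

Lemma measurable_restriction_preimage (d : nat) (S : pfinType)
    (L : {fset lattice d}) (B : set {ffun L -> S}) :
  measurable (@restriction d S L @^-1` B).
Proof.
by rewrite -[X in measurable X]setTI; exact: measurable_restriction.
Qed.

Lemma fin_prob_marginal (R : realType) (d : nat) (S : pfinType)
    (L : {fset lattice d}) (mu : probability (configuration d S) R) :
  fin_prob (marginal_weight (L := L) mu).
Proof.
exact: (fin_prob_preimage mu (@measurable_restriction_preimage d S L)).
Qed.

Lemma integral_loc (R : realType) (d : nat) (S : pfinType)
    (L : {fset lattice d}) (mu : probability (configuration d S) R)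
    (f : configuration d S -> R) : loc L f ->
  (\int[mu]_s (f s)%:E)%E =
    (\sum_x marginal_weight mu x * f (extension (x : {ffun L -> S})))%:E.
Proof.
move=> Lf; under eq_integral do rewrite (loc_extension _ Lf).
have [_ ->] := integrable_fin_factor mu (f \o @extension d S L)
  (@measurable_restriction_preimage d S L).
by congr EFin; apply: eq_bigr => x _; rewrite mulrC.
Qed.

Lemma log_laplace_loc (R : realType) (d : nat) (S : pfinType)
    (L : {fset lattice d}) (mu : probability (configuration d S) R)
    (f : configuration d S -> R) : loc L f ->
  lne (\int[mu]_s (expR (f s - \int[mu]_t f t)%R)%:E)%E =
    (ln (\sum_x marginal_weight mu x * expR (f (extension (x : {ffun L -> S}))
      - \sum_y marginal_weight mu y * f (extension (y : {ffun L -> S})))))%:E.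
Proof.
move=> Lf; rewrite /Rintegral (integral_loc mu Lf)/= (@integral_loc _ _ _ L).
  by rewrite lne_EFin// fin_expsum_gt0//; exact: fin_prob_marginal.
by move=> s t st; rewrite (Lf s t).
Qed.

Lemma oscillation_ge0 (R : realType) (d : nat) (S : pfinType)
  (f : configuration d S -> R) i : (0 <= oscillation f i)%E.
Proof.
apply: ereal_sup_ubound => /=; exists point, point.
by split => //; rewrite subrr.
Qed.

Lemma oscillation_loc0 (R : realType) (d : nat) (S : pfinType)
    (L : {fset lattice d}) (f : configuration d S -> R) i :
  loc L f -> i \notin L -> oscillation f i = 0%E.
Proof.
move=> Lf iL; apply/le_anti; rewrite oscillation_ge0 andbT.
apply: ge_ereal_sup => _ [s [t [st ->]]].
rewrite (Lf s t) ?subrr// => j jL; apply: st.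
by apply: contraNneq iL => <-.
Qed.

Lemma oscillation_sqnorm_loc (R : realType) (d : nat) (S : pfinType)
    (L : {fset lattice d}) (f : configuration d S -> R) : loc L f ->
  oscillation_sqnorm f = (\sum_(i : L) oscillation f (val i) ^+ 2)%E.
Proof.
move=> Lf; rewrite -(big_seq_fsetE _ _ predT (fun i => oscillation f i ^+ 2)%E)/=.
rewrite /oscillation_sqnorm.
rewrite (_ : esum _ _ = \esum_(i in [set` L]) oscillation f i ^+ 2)%E.
  rewrite esum_fset//; last by move=> i _; rewrite expe_ge0// oscillation_ge0.
  by rewrite fsbig_finite//= set_fsetK.
rewrite [RHS]esum_mkcond; apply: eq_esum => i _.
case: ifPn => //; rewrite notin_setE/= => /negP iL.
by rewrite (oscillation_loc0 Lf iL) mule0.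
Qed.

Lemma oscillation_le (R : realType) (d : nat) (S : pfinType)
    (L : {fset lattice d}) (g : {ffun L -> S} -> R) (a : L -> R) (i : L) :
  osc_bound g a ->
  (oscillation (g \o @restriction d S L) (val i) <= (a i)%:E)%E.
Proof.
move=> osc; apply: ge_ereal_sup => _ [s [t [st ->]]].
rewrite lee_fin; apply: osc => j ji; rewrite !ffunE; apply: st.
by rewrite (inj_eq val_inj).
Qed.

Lemma oscillation_loc_fin (R : realType) (d : nat) (S : pfinType)
    (L : {fset lattice d}) (f : configuration d S -> R) i :
  loc L f -> oscillation f i \is a fin_num.
Proof.
move=> Lf; rewrite ge0_fin_numE ?oscillation_ge0//.
(* A crude uniform bound on [f], which takes finitely many values. *)
pose M := \sum_(x : {ffun L -> S}) `|f (extension x)|.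
apply: (@le_lt_trans _ _ (M + M)%:E); last by rewrite ltry.
apply: ge_ereal_sup => _ [s [t [_ ->]]]; rewrite lee_fin.
have bound u : `|f u| <= M.
  rewrite (loc_extension u Lf) /M (bigD1 (restriction L u))//= lerDl.
  exact: sumr_ge0.
have := bound s; have := bound t; rewrite !ler_norml; lra.
Qed.

Lemma osc_bound_extension (R : realType) (d : nat) (S : pfinType)
    (L : {fset lattice d}) (f : configuration d S -> R) : loc L f ->
  osc_bound (f \o @extension d S L) (fun i => fine (oscillation f (val i))).
Proof.
move=> Lf i x y xy /=; rewrite -lee_fin fineK ?(oscillation_loc_fin _ Lf)//.
apply: ereal_sup_ubound => /=; exists (extension x), (extension y).
(* Outside the volume both extensions take the same default spin, so only sites of [L] need
   checking. *)
split => // j ji; rewrite /extension; case: insubP => // k _ kj.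
by apply: xy; apply: contraNneq ji => <-; rewrite kj.
Qed.

Lemma marginal_sum (R : realType) (d : nat) (S : pfinType)
    (L : {fset lattice d}) (mu : probability (configuration d S) R) A :
  marginal L mu A = (\sum_x marginal_weight (L := L) mu x * \1_A x)%:E.
Proof.
have := probability_preimage_sum mu (fun x => x \in A)
  (@measurable_restriction_preimage d S L).
rewrite (_ : [set` _] = A); last by apply/seteqP; split=> x; rewrite /= inE.
rewrite -[marginal L mu A]/(mu (restriction L @^-1` A)) => ->; congr EFin.
rewrite big_mkcond; apply: eq_bigr => x _.
by rewrite indicE; case: (x \in A); rewrite ?mulr1 ?mulr0.
Qed.

(** On a finite discrete space null sets are unions of null atoms, so domination can be tested on
    atoms. *)
Lemma marginal_dominatesP (R : realType) (d : nat) (S : pfinType)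
    (L : {fset lattice d}) (mu nu : probability (configuration d S) R) :
  marginal L nu `<< marginal L mu <->
  forall x, marginal_weight (L := L) mu x = 0 -> marginal_weight nu x = 0.
Proof.
rewrite null_content_dominatesP; split=> [dom x|dom A _ A0].
  rewrite /marginal_weight => mu0; rewrite (dom [set x])//.
  by rewrite -[LHS]fineK ?fin_num_measure// mu0.
rewrite marginal_sum big1// => x _; rewrite indicE.
have [/set_mem xA|] := boolP (x \in A); last by rewrite mulr0.
rewrite mulr1; apply: dom; rewrite /marginal_weight.
suff -> : marginal L mu [set x] = 0%E by [].
apply/eqP; rewrite -measure_le0 -[leRHS]A0 le_measure ?inE// => _ -> //.
Qed.

Lemma relative_entropyE (R : realType) (d : nat) (S : pfinType)
    (L : {fset lattice d}) (mu nu : probability (configuration d S) R) :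
  (forall x, marginal_weight (L := L) mu x = 0 -> marginal_weight nu x = 0) ->
  relative_entropy L nu mu =
    (fin_entropy (marginal_weight (L := L) nu) (marginal_weight mu))%:E.
Proof. by move=> /marginal_dominatesP dom; rewrite /relative_entropy asboolT. Qed.

(** The product sigma-algebra is again discrete: every set is a finite union of one-point
    rectangles. *)
Lemma measurable_local_pair (d : nat) (S : pfinType) (L : {fset lattice d})
    (B : set (local_configuration S L * local_configuration S L)) :
  measurable B.
Proof.
rewrite -[B]image_id -bigcup_imset1.
apply: fin_bigcup_measurable => [|[x y] _]; first exact: finite_finset.
rewrite (_ : [set (x, y)] = [set x] `*` [set y]); first exact: measurableX.
by apply/seteqP; split => -[x' y'] /= [-> ->].
Qed.

Lemma Q2_le_coupling (R : realType) (d : nat) (S : pfinType)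
    (L : {fset lattice d}) (mu nu : probability (configuration d S) R) w r :
  fin_coupling (marginal_weight (L := L) mu) (marginal_weight nu) w ->
  \sum_i (\sum_z w z * mismatch R i z) ^+ 2 <= r ->
  (Q2 L mu nu <= sqrte r%:E)%E.
Proof.
move=> [w0 w1 w2] wr.
(* The total mass is inherited from the first marginal. *)
have ww : fin_prob w.
  split=> //; have [_ <-] := fin_prob_marginal L mu.
  under [RHS]eq_bigr do rewrite -w1.
  by rewrite pair_bigA/=; apply: eq_bigr => -[].
have [P PE] := exists_discrete_probability
  (fun z => z : local_configuration S L * local_configuration S L) ww.
rewrite /Q2 lee_sqrt; last first.
  by rewrite lee_fin (le_trans _ wr)// sumr_ge0// => i _; exact: sqr_ge0.
apply: ereal_inf_le; eexists; last first.
  rewrite -lee_fin in wr; exact: wr.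
exists P.
  split=> [A _|A _]; rewrite marginal_sum PE; congr EFin.
    by rewrite (pair_sum_fst w \1_A); apply: eq_bigr => x _; rewrite w1.
  by rewrite (pair_sum_snd w \1_A); apply: eq_bigr => x _; rewrite w2.
rewrite -sumEFin; apply: eq_bigr => i _; rewrite EFin_expe; congr (_ ^+ 2)%E.
rewrite PE; congr EFin; apply: eq_bigr => z _; congr (_ * _).
rewrite indicE /mismatch; have [e|e] := eqVneq (z.1 i) (z.2 i).
  by rewrite memNset//= e eqxx.
by rewrite mem_set.
Qed.

(** A coupling is picked strictly below [r + e], so the infimum need not be attained. *)
Lemma coupling_of_Q2_le (R : realType) (d : nat) (S : pfinType)
    (L : {fset lattice d}) (mu nu : probability (configuration d S) R) r e :
  0 <= r -> 0 < e -> (Q2 L mu nu <= sqrte r%:E)%E ->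
  exists2 w, fin_coupling (marginal_weight (L := L) mu) (marginal_weight nu) w
    & \sum_i (\sum_z w z * mismatch R i z) ^+ 2 <= r + e.
Proof.
move=> r0 e0; rewrite /Q2 lee_sqrt ?lee_fin// => Qr.
have re : (r%:E < (r + e)%:E)%E by rewrite lte_fin ltrDl.
have [_ [P [P1 P2] <-]] := ereal_inf_lt (le_lt_trans Qr re).
have mid B : measurable ((fun z : local_configuration S L *
    local_configuration S L => z) @^-1` B) by exact: measurable_local_pair.
pose w (z : {ffun L -> S} * {ffun L -> S}) := fine (P [set z]).
have PE (B : pred ({ffun L -> S} * {ffun L -> S})) :
    P [set` B] = (\sum_z w z * (B z)%:R)%:E.
  rewrite (probability_preimage_sum P B mid) big_mkcond; congr EFin.
  by apply: eq_bigr => z _; case: (B z); rewrite ?mulr1 ?mulr0.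
have wP : fin_coupling (marginal_weight (L := L) mu) (marginal_weight nu) w.
  split=> [z|x|y]; first exact: fine_ge0.
    rewrite /marginal_weight -P1//.
    rewrite (_ : fst @^-1` [set x] = [set` [pred z | z.1 == x]]).
      rewrite PE/= (pair_sum_fst w (fun x' => (x' == x)%:R)) [RHS](bigD1 x)//= eqxx.
      by rewrite mulr1 [X in _ = _ + X]big1 ?addr0// => x' /negbTE ->; rewrite mulr0.
    by apply/seteqP; split => z /= /eqP.
  rewrite /marginal_weight -P2//.
  rewrite (_ : snd @^-1` [set y] = [set` [pred z | z.2 == y]]).
    rewrite PE/= (pair_sum_snd w (fun y' => (y' == y)%:R)) [RHS](bigD1 y)//= eqxx.
    by rewrite mulr1 [X in _ = _ + X]big1 ?addr0// => y' /negbTE ->; rewrite mulr0.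
  by apply/seteqP; split => z /= /eqP.
under eq_bigr => i _.
  rewrite (PE (fun z => z.1 i != z.2 i)) -EFin_expe; over.
by rewrite sumEFin lte_fin => /ltW cost; exists w.
Qed.

(** * Transfer between the lattice and the finite volume *)

Lemma gcb_marginal (R : realType) (d : nat) (S : pfinType)
    (L : {fset lattice d}) (mu : probability (configuration d S) R) (C : R) :
  0 < C ->
  (forall f : configuration d S -> R, loc L f ->
    lne (\int[mu]_s (expR (f s - \int[mu]_t f t)%R)%:E) <=
      (C / 2)%:E * oscillation_sqnorm f)%E ->
  fin_gcb C (marginal_weight (L := L) mu).
Proof.
move=> C0 gcb g a osc; pose f : configuration d S -> R := g \o @restriction d S L.
have Lf : loc L f.
  move=> s t st; rewrite /f/=; congr g; apply/ffunP => j.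
  by rewrite !ffunE; apply: st; exact: valP.
have := gcb f Lf; rewrite (log_laplace_loc mu Lf) (oscillation_sqnorm_loc Lf).
under eq_bigr do rewrite /f/= extensionK.
under [X in ln (\sum_x _ * expR (_ - X))]eq_bigr do rewrite /f/= extensionK.
(* The lifted function oscillates by at most [a i] at each site, and squaring preserves this since
   oscillations are nonnegative. *)
rewrite -lee_fin => /le_trans; apply.
rewrite (EFinM (C / 2)) lee_pmul2l ?lte_fin ?divr_gt0// -sumEFin.
apply: lee_sum => i _; rewrite EFin_expe !expe2.
by apply: lee_pmul; rewrite ?oscillation_ge0// oscillation_le.
Qed.

(** Pushing [w] forward along [extension] gives such a measure; this makes tilted marginals
    admissible in the transport inequality. *)
Lemma marginal_weight_extension (R : realType) (d : nat) (S : pfinType)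
    (L : {fset lattice d}) (w : {ffun L -> S} -> R) : fin_prob w ->
  exists nu : probability (configuration d S) R,
    marginal_weight (L := L) nu = w.
Proof.
move=> ww; have [nu nuE] := exists_discrete_probability (@extension d S L) ww.
exists nu; apply/funext => x.
rewrite /marginal_weight [marginal L nu _]nuE/= (bigD1 x)//= indicE mem_set.
  rewrite mulr1 big1 ?addr0// => y yx; rewrite indicE memNset ?mulr0//=.
  by rewrite extensionK; exact/eqP.
by rewrite /= extensionK.
Qed.

Lemma transport_gcb (R : realType) (d : nat) (S : pfinType)
    (L : {fset lattice d}) (mu : probability (configuration d S) R) (C : R)
    (f : configuration d S -> R) : 0 < C ->
  (forall nu : probability (configuration d S) R,
    Q2 L mu nu <= sqrte ((2 * C)%:E * relative_entropy L nu mu))%E ->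
  loc L f ->
  (lne (\int[mu]_s (expR (f s - \int[mu]_t f t)%R)%:E) <=
    (C / 2)%:E * oscillation_sqnorm f)%E.
Proof.
move=> C0 trans Lf; rewrite (log_laplace_loc mu Lf) (oscillation_sqnorm_loc Lf).
have -> : (\sum_(i : L) oscillation f (val i) ^+ 2 =
    (\sum_(i : L) fine (oscillation f (val i)) ^+ 2)%:E)%E.
  rewrite -sumEFin; apply: eq_bigr => i _.
  by rewrite EFin_expe fineK// (oscillation_loc_fin _ Lf).
rewrite -EFinM lee_fin.
have pp := fin_prob_marginal L mu.
have qq := fin_prob_tilt (f \o @extension d S L) pp.
have [nu nuE] := marginal_weight_extension qq.
have dom x : marginal_weight (L := L) mu x = 0 -> marginal_weight nu x = 0.
  by rewrite nuE /tilt => ->; rewrite !mul0r.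
have := trans nu; rewrite relative_entropyE// -EFinM => Qr.
have := @fin_transport_gcb _ _ _ C _ (f \o @extension d S L) _ C0 pp.
apply; last exact: osc_bound_extension.
move=> e e0; rewrite -nuE; apply: coupling_of_Q2_le => //.
rewrite mulr_ge0 ?fin_entropy_ge0//; first by rewrite mulr_ge0// ltW.
by rewrite nuE.
Qed.

Local Open Scope ereal_scope.

Theorem theorem4p2 (R : realType) (d : nat) (hd : (1 <= d)%N) (S : pfinType)
    (mu : probability (configuration d S) R) :
  (exists C : R, (0 < C)%R /\
    forall L : {fset lattice d}, L != fset0 ->
    forall f : configuration d S -> R, loc L f ->
      lne (\int[mu]_s (expR (f s - \int[mu]_t f t)%R)%:E) <=
        (C / 2)%:E * oscillation_sqnorm f)
  <->
  (exists C : R, (0 < C)%R /\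
    forall L : {fset lattice d}, L != fset0 ->
    forall nu : probability (configuration d S) R,
      Q2 L mu nu <= sqrte ((2 * C)%:E * relative_entropy L nu mu)).
Proof.
(* The same constant serves in both directions. *)
split=> -[C [C0 H]]; exists C; split=> // L L0; last first.
  by move=> f; exact: transport_gcb (H L L0).
move=> nu; have [dom|ndom] := pselect (marginal L nu `<< marginal L mu); last first.
  (* Without domination the entropy is infinite and the bound is trivial. *)
  rewrite /relative_entropy asboolF// gt0_muley ?lte_fin ?mulr_gt0//.
  by rewrite leey.
move/marginal_dominatesP : dom => dom; rewrite relative_entropyE// -EFinM.
have gcb := gcb_marginal C0 (H L L0).
have [w cpl cost] := fin_gcb_transport C0 (fin_prob_marginal L mu)
  (fin_prob_marginal L nu) dom gcb.
exact: Q2_le_coupling cpl cost.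
Qed.
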